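(* Let $n$ be a positive integer, let $A_n=(\{1,2,\dots,2^n\},* )$ be the Laver table, and let $A_n^{T}=(\{1,2,\dots,2^n\},\circ)$ be the right self-distributive magma obtained by transposing it, i.e. $x\circ y=y*x$. Then $\widetilde{H}^{(\circ)}_m(A_n^T)=0$ for all $m\ge0$ (the reduced one-term homology groups are trivial in all dimensions), and $H^R_m(A_n^T)\cong\mathbb{Z}$ for all $m\ge0$ (the two-term (rack) homology groups are $\mathbb{Z}$ in all dimensions).
   Context: The Laver table $A_n$ is the unique left self-distributive magma $(\{1,2,\dots,2^n\},* )$, i.e. satisfying $a*(b*c)=(a*b)*(a*c)$ for all $a,b,c$, such that $a*1\equiv a+1 \pmod{2^n}$ for all $a$ (residues represented in $\{1,\dots,2^n\}$). Its existence and uniqueness are due to Laver. A (right) shelf is a set $X$ with a binary operation $\circ$ satisfying $(a\circ b)\circ c=(a\circ c)\circ(b\circ c)$. Homology of a (right) shelf $(X,\circ)$: for $m\ge 0$ let $C_m=\mathbb{Z}X^{m+1}$ be the free abelian group on $(m+1)$-tuples $(x_0,\dots,x_m)$. For $m\ge1$ and $0\le i\le m$ put $d^{(\circ)}_{i,m}(x_0,\dots,x_m)=(x_0\circ x_i,\dots,x_{i-1}\circ x_i,x_{i+1},\dots,x_m)$ (so $d^{(\circ)}_{0,m}$ gives $(x_1,\dots,x_m)$) and $d^{(\circ_0)}_{i,m}(x_0,\dots,x_m)=(x_0,\dots,x_{i-1},x_{i+1},\dots,x_m)$, extended linearly. One-term homology: $\partial^{(\circ)}_m=\sum_{i=0}^m(-1)^i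 d^{(\circ)}_{i,m}$ for $m\ge1$; the reduced (augmented) one-term homology $\widetilde{H}^{(\circ)}_m(X)$ is the homology of the complex $(C_m,\partial^{(\circ)}_m)$ augmented by $C_{-1}=\mathbb{Z}$ and $\partial_0:C_0\to\mathbb{Z}$, $x_0\mapsto1$. Two-term (rack) homology: $\partial^R_m=\sum_{i=0}^m(-1)^i\bigl(d^{(\circ_0)}_{i,m}-d^{(\circ)}_{i,m}\bigr)$ for $m\ge 1$, $\partial^R_0=0$, and $H^R_m(X)=\ker(\partial^R_m)/\mathrm{im}(\partial^R_{m+1})$. *)

(* Defs.v *)
From HB Require Import structures.
From mathcomp Require Import freeg.
From mathcomp Require Import all_boot all_order all_algebra.
From mathcomp Require Import boolp zify.

Set Implicit Arguments.
Unset Strict Implicit.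
Unset Printing Implicit Defensive.

Import GRing.Theory.
Local Open Scope ring_scope.

Section Homology.
Variables (U V W : zmodType) (f : {additive U -> V}) (g : {additive V -> W}).

Definition cycle_pred : {pred V} := fun v => g v == 0.

Fact cycle_zmod_closed : zmod_closed cycle_pred.
Proof.
split=> [|x y]; rewrite /cycle_pred !unfold_in ?raddf0 //.
by move=> /eqP gx /eqP gy; rewrite raddfB gx gy subr0.
Qed.

HB.instance Definition _ :=
  GRing.isZmodClosed.Build V cycle_pred cycle_zmod_closed.

Record cycles := Cycle { cycle_val :> V; _ : cycle_val \in cycle_pred }.

HB.instance Definition _ := [isSub for cycle_val].
HB.instance Definition _ := [Choice of cycles by <:].
HB.instance Definition _ := [SubChoice_isSubZmodule of cycles by <:].

(* Membership is a Prop turned into a bool classically, because quotients of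
   zmodTypes are taken by boolean predicates. *)
Definition boundary_pred : {pred cycles} :=
  fun z => `[< exists u : U, f u = cycle_val z >].

Fact boundary_zmod_closed : zmod_closed boundary_pred.
Proof.
split=> [|x y]; first by apply/asboolP; exists 0; rewrite raddf0.
move=> /asboolP[u fu] /asboolP[v fv]; apply/asboolP; exists (u - v).
by rewrite raddfB fu fv.
Qed.

HB.instance Definition _ :=
  GRing.isZmodClosed.Build cycles boundary_pred boundary_zmod_closed.

(* ker g / im f. The boundaries are those elements of ker g that lie in im f;
   all pairs used below satisfy g \o f = 0 (one_term_complex and rack_complex),
   so these are all of im f. *)
Definition homology : zmodType := {ideal_quot boundary_pred}.

End Homology.

Definition zmod_isomorphic (U V : zmodType) : Prop :=
  exists phi : {additive U -> V}, bijective phi.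

Definition right_self_distributive (X : Type) (op : X -> X -> X) : Prop :=
  forall a b c, op (op a b) c = op (op a c) (op b c).

Section ShelfComplex.
Variable X : choiceType.
Implicit Types (op : X -> X -> X) (m : nat).

Definition chain m : lmodType int := {freeg (m.+1.-tuple X) / int}.

Definition face_tuple op m (i : 'I_m.+2) (x : m.+2.-tuple X) : m.+1.-tuple X :=
  [tuple let y := tnth x (lift i j) in
         if (j < i)%N then op y (tnth x i) else y | j < m.+1].

(* face op m i is d_{i,m+1}, and likewise bd op m is the boundary of degree
   m+1: the source degree is a successor. *)
Definition face op m (i : 'I_m.+2) : chain m.+1 -> chain m :=
  fglift (fun x => << face_tuple op i x >> : chain m).

(* a \circ_0 b = a *)
Definition op0 (a b : X) : X := a.

Definition one_term_bd op m (c : chain m.+1) : chain m :=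
  \sum_(i < m.+2) (-1) ^+ i *: face op i c.

Definition rack_bd op m (c : chain m.+1) : chain m :=
  \sum_(i < m.+2) (-1) ^+ i *: (face op0 i c - face op i c).

Definition augmentation : chain 0 -> int :=
  fglift (fun _ => 1 : int^o).

Lemma face_is_additive op m (i : 'I_m.+2) : zmod_morphism (face op i).
Proof. exact: lift_is_additive. Qed.
HB.instance Definition _ op m (i : 'I_m.+2) :=
  GRing.isZmodMorphism.Build (chain m.+1) (chain m) (face op i)
    (face_is_additive op i).

Lemma one_term_bd_is_additive op m : zmod_morphism (@one_term_bd op m).
Proof.
by move=> c d; rewrite -sumrB; apply: eq_bigr => i _; rewrite raddfB scalerBr.
Qed.
HB.instance Definition _ op m :=
  GRing.isZmodMorphism.Build (chain m.+1) (chain m) (@one_term_bd op m)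
    (@one_term_bd_is_additive op m).

Lemma rack_bd_is_additive op m : zmod_morphism (@rack_bd op m).
Proof.
move=> c d; rewrite -sumrB; apply: eq_bigr => i _.
rewrite -scalerBr; congr (_ *: _).
by rewrite !(raddfB (face _ _)) !opprD addrACA.
Qed.
HB.instance Definition _ op m :=
  GRing.isZmodMorphism.Build (chain m.+1) (chain m) (@rack_bd op m)
    (@rack_bd_is_additive op m).

Lemma augmentation_is_additive : zmod_morphism augmentation.
Proof. exact: (@lift_is_additive _ _ int^o). Qed.
HB.instance Definition _ :=
  GRing.isZmodMorphism.Build (chain 0) int augmentation
    augmentation_is_additive.

(* The chain groups with C_{-1} = Z, shifted by one: achain m = C_{m-1}. *)
Definition achain m : zmodType := if m is m'.+1 then chain m' else int.

(* augmented_bd op m is the degree m boundary of the augmented one-term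
   complex; rack_bd0 op m is \partial^R_m, with \partial^R_0 = 0. *)
Definition augmented_bd op m : {additive achain m.+1 -> achain m} :=
  match m with
  | 0 => augmentation
  | m'.+1 => @one_term_bd op m'
  end.

Definition rack_bd0 op m : {additive achain m.+1 -> achain m} :=
  match m with
  | 0 => \0
  | m'.+1 => @rack_bd op m'
  end.

Definition reduced_one_term_homology op m : zmodType :=
  homology (augmented_bd op m.+1) (augmented_bd op m).

Definition rack_homology op m : zmodType :=
  homology (rack_bd0 op m.+1) (rack_bd0 op m).

End ShelfComplex.

Section ComplexTheory.
Variable X : choiceType.
Implicit Types (a b op : X -> X -> X) (m : nat).

Lemma freeg_ext (K : choiceType) (M : zmodType)
    (f g : {additive {freeg K / int} -> M}) :
  (forall x, f << x >> = g << x >>) -> f =1 g.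
Proof.
move=> fg D; elim/freeg_ind_dom0: D => [|k x D _ _ IH]; first by rewrite !raddf0.
have -> : << k *g x >> = << x >> *~ k :> {freeg K / int}.
  by rewrite freegU_mulz intz.
by rewrite !raddfD IH !raddfMz fg.
Qed.

Lemma nth_face_tuple x0 op m (i : 'I_m.+2) (x : m.+2.-tuple X) k :
  (k < m.+1)%N ->
  nth x0 (face_tuple op i x) k =
    if (k < i)%N then op (nth x0 x k) (nth x0 x i) else nth x0 x k.+1.
Proof.
move=> lt_km; rewrite -[k]/(nat_of_ord (Ordinal lt_km)) -tnth_nth tnth_mktuple.
by rewrite !(tnth_nth x0) /= /bump; case: ltnP.
Qed.

Lemma face_tuple_comm a b m (i j : 'I_m.+2) (x : m.+3.-tuple X) :
  (forall u v w, a (b u w) (b v w) = b (a u v) w) -> (i <= j)%N ->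
  face_tuple a i (face_tuple b (lift ord0 j) x) =
  face_tuple b j (face_tuple a (widen_ord (leqnSn _) i) x).
Proof.
move=> ab le_ij; apply: val_inj; set x0 := tnth x ord0.
apply: (@eq_from_nth _ x0); rewrite !size_tuple // => k lt_km.
have := ltn_ord j; have := ltn_ord i => lti ltj.
rewrite !nth_face_tuple ?(ltnW lt_km) //= /bump /=; try lia.
rewrite !add1n.
have [lt_ki|le_ik] := ltnP k i.
  have -> : (k < j.+1)%N by lia.
  have -> : (i < j.+1)%N by lia.
  have -> : (k < j)%N by lia.
  have -> : (j < i)%N = false by lia.
  exact: ab.
have -> : (k.+1 < i)%N = false by lia.
have -> : (j < i)%N = false by lia.
by rewrite ltnS.
Qed.

Lemma face_comm a b m (i j : 'I_m.+2) (c : chain X m.+2) :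
  (forall u v w, a (b u w) (b v w) = b (a u v) w) -> (i <= j)%N ->
  face a i (face b (lift ord0 j) c) =
  face b j (face a (widen_ord (leqnSn _) i) c).
Proof.
move=> ab le_ij.
pose f := face a i \o face b (lift ord0 j).
pose g := face b j \o face a (widen_ord (leqnSn _) i).
apply: (@freeg_ext _ _ f g) => x.
by rewrite /f /g /= /face !liftU !scale1r !liftU face_tuple_comm.
Qed.

Lemma one_term_bd_comp_antisym m (c : chain X m.+2) :
  exists L : (X -> X -> X) -> (X -> X -> X) -> chain X m, forall a b,
  (forall u v w, b (a u w) (a v w) = a (b u v) w) ->
  one_term_bd a (one_term_bd b c) = L a b - L b a.
Proof.
pose T p q (i : 'I_m.+2) (j : 'I_m.+3) : chain X m :=
  (-1) ^+ (i + j) *: face p i (face q j c).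
pose L p q := \sum_(j < m.+3) \sum_(i < m.+2 | (i < j)%N) T p q i j.
pose G p q := \sum_(j < m.+3) \sum_(i < m.+2 | (j <= i)%N) T p q i j.
have LG p q : (forall u v w, p (q u w) (q v w) = q (p u v) w) ->
    L p q = - G q p.
  move=> pq; rewrite /L big_ord_recl big_pred0 ?add0r; last by [].
  rewrite /G [X in - X](exchange_big_dep xpredT) //= -sumrN.
  apply: eq_bigr => j _.
  rewrite [X in - X]big_mkcond big_ord_recr /= leqNgt ltn_ord addr0.
  rewrite -big_mkcond -sumrN /=; apply: eq_big => [i|i].
    by rewrite /= /bump ltnS.
  rewrite /bump /= add1n ltnS => le_ij.
  rewrite /T face_comm // -scaleNr; congr (_ *: _) => /=.
  by rewrite /bump add1n addnS exprS mulN1r addnC.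
exists L => a b ba; rewrite (LG b a ba) opprK.
rewrite /one_term_bd -big_split /= (eq_bigr (fun j => \sum_(i < m.+2) T a b i j)).
  rewrite exchange_big /=; apply: eq_bigr => i _.
  rewrite raddf_sum scaler_sumr; apply: eq_bigr => j _.
  by rewrite /T exprD -scalerA raddfZsign.
move=> j _; rewrite [RHS](bigID (fun i : 'I__ => (i < j)%N)) /=.
by congr (_ + _); apply: eq_bigl => i; rewrite -leqNgt.
Qed.

Lemma one_term_bd_bd op m (c : chain X m.+2) :
  right_self_distributive op -> one_term_bd op (one_term_bd op c) = 0.
Proof.
move=> sd; have [L LE] := one_term_bd_comp_antisym c.
by rewrite LE ?subrr.
Qed.

Lemma rack_bdE op m (c : chain X m.+1) :
  rack_bd op c = one_term_bd (@op0 X) c - one_term_bd op c.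
Proof. by rewrite -sumrB; apply: eq_bigr => i _; rewrite scalerBr. Qed.

Lemma rack_bd_bd op m (c : chain X m.+2) :
  right_self_distributive op -> rack_bd op (rack_bd op c) = 0.
Proof.
move=> sd; have [L LE] := one_term_bd_comp_antisym c.
rewrite !rack_bdE !raddfB /= !LE // !subrr oppr0 subr0 sub0r.
by rewrite -opprD addrC addrA subrK subrr oppr0.
Qed.

Lemma one_term_complex op m (c : achain X m.+2) :
  right_self_distributive op ->
  augmented_bd op m (augmented_bd op m.+1 c) = 0.
Proof.
case: m c => [|m] c sd; last exact: one_term_bd_bd.
pose f := @augmentation X \o one_term_bd op (m:=0).
apply: (@freeg_ext _ _ f \0) => x /=.
rewrite /f /= /one_term_bd !big_ord_recl big_ord0 addr0 /face !liftU !scale1r.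
by rewrite scaleN1r raddfB /= /augmentation !liftU subrr.
Qed.

Lemma rack_complex op m (c : achain X m.+2) :
  right_self_distributive op -> rack_bd0 op m (rack_bd0 op m.+1 c) = 0.
Proof. by case: m c => [|m] c sd //; apply: rack_bd_bd. Qed.

End ComplexTheory.

(* {1, ..., 2^n} *)
Definition laver_carrier (n : nat) := {k : nat | (0 < k <= 2 ^ n)%N}.

Fact laver_one_subproof n : (0 < 1 <= 2 ^ n)%N.
Proof. by rewrite expn_gt0. Qed.

Definition laver_one n : laver_carrier n :=
  exist (fun k => is_true (0 < k <= 2 ^ n)%N) 1%N (laver_one_subproof n).

Record is_laver_table n
    (star : laver_carrier n -> laver_carrier n -> laver_carrier n) : Prop := {
  laver_left_distributive :
    forall a b c, star a (star b c) = star (star a b) (star a c);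
  laver_mul_one :
    forall a, (sval (star a (laver_one n)) = sval a + 1 %[mod 2 ^ n])%N
}.

Definition transpose_op (X : Type) (star : X -> X -> X) : X -> X -> X :=
  fun x y => star y x.

Lemma laver_transpose_right_self_distributive n star :
  @is_laver_table n star -> right_self_distributive (transpose_op star).
Proof. by move=> h a b c; apply: (laver_left_distributive h). Qed.

(* Main.v *)
Require Import Defs.
From HB Require Import structures.
From mathcomp Require Import freeg.
From mathcomp Require Import all_boot all_order all_algebra.
From mathcomp Require Import boolp zify.

Set Implicit Arguments.
Unset Strict Implicit.
Unset Printing Implicit Defensive.

Import GRing.Theory.
Local Open Scope ring_scope.
Local Open Scope quotient_scope.

(** Write [N = 2 ^ n] and [x o y = y * x]. Left distributivity and the rule for
    [a * 1] give, by induction on [x], [N * x = x] and [(N - 1) * x = N].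
    So the right translation by [N] is the identity, and the right translation
    by [N - 1] is the constant [N].

    Both results come from one operation on chains: appending a fixed element
    [y] at the end of every tuple. It commutes with all faces except the new
    last one, and the last face of [(x_0, ..., x_m, y)] is
    [(x_0 o y, ..., x_m o y)] ([augmented_bd_cone]).
    - For [y = N] the last face is the identity, so, up to sign, appending [N]
      contracts the augmented one-term complex
      ([reduced_one_term_homology_eq0]).
    - In the rack complex the last face contributes
      [(x_0, ..., x_m) - (x_0 o y, ..., x_m o y)] ([rack_bd0_cone]). For
      [y = N - 1] the second tuple is [(N, ..., N)], so every cycle [c] is
      homologous to [deg c] times the cycle [(N, ..., N)], where [deg] is the
      sum of the coefficients. As [deg] vanishes on boundaries, it identifies
      the homology with the integers ([rack_homology_int]). *)

(** * Vanishing and infinite cyclic homology *)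

Section HomologyCriteria.
Variables (U V W : zmodType) (f : {additive U -> V}) (g : {additive V -> W}).

Lemma pi_homology_eq (y z : cycles g) :
  \pi_(homology f g) y = \pi_(homology f g) z <->
  exists u, f u = cycle_val y - cycle_val z.
Proof.
split=> [/eqP|yz].
  by rewrite -Quotient.idealrBE => /asboolP.
by apply/eqP; rewrite -Quotient.idealrBE; apply/asboolP.
Qed.

Lemma homology_eq0 :
    (forall v, g v = 0 -> exists u, f u = v) ->
  forall h : homology f g, h = 0.
Proof.
move=> exact_fg; elim/quotW=> z.
rewrite -(raddf0 (\pi_(homology f g))); apply/pi_homology_eq.
by have [u fu] := exact_fg _ (eqP (valP z)); exists u; rewrite subr0.
Qed.

(** If [eps] kills exactly the boundaries among the cycles and takes the value
    1 on some cycle, then it induces an isomorphism from homology to the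
    integers. *)
Lemma homology_int (eps : {additive V -> int}) (w : V) :
    (forall u, eps (f u) = 0) -> g w = 0 -> eps w = 1 ->
    (forall v, g v = 0 -> eps v = 0 -> exists u, f u = v) ->
  zmod_isomorphic (homology f g) int.
Proof.
move=> eps_f gw eps_w eps_inj.
(* eps read on an arbitrary representative; independence is phi_pi. *)
pose phi (h : homology f g) : int := eps (cycle_val (repr h)).
have phi_pi (z : cycles g) : phi (\pi_(homology f g) z) = eps (cycle_val z).
  have [|u fu] := (pi_homology_eq (repr (\pi_(homology f g) z)) z).1.
    by rewrite reprK.
  by apply/eqP; rewrite -subr_eq0 -raddfB -fu eps_f.
have phi_additive : zmod_morphism phi.
  elim/quotW=> y; elim/quotW=> z.
  by rewrite -raddfB !phi_pi raddfB.
pose phiM := GRing.isZmodMorphism.Build _ _ phi phi_additive.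
pose phiA : {additive homology f g -> int} := HB.pack phi phiM.
have wk_cycle (k : int) : w *~ k \in cycle_pred g.
  by rewrite unfold_in /cycle_pred raddfMz gw mul0rz.
exists phiA; exists (fun k => \pi_(homology f g) (Cycle (wk_cycle k)))
  => [|k] /=; last first.
  by rewrite phi_pi raddfMz eps_w intz.
elim/quotW=> z; rewrite phi_pi; apply/pi_homology_eq; apply: eps_inj => /=.
  by rewrite raddfB raddfMz gw mul0rz (eqP (valP z)) subrr.
by rewrite raddfB raddfMz eps_w intz subrr.
Qed.

End HomologyCriteria.

(** * Appending an element to a chain *)

Section Cone.
Variable X : choiceType.
Implicit Types (op : X -> X -> X) (m : nat) (y : X).

(** [(x_0, ..., x_m) |-> (x_0, ..., x_m, y)]. *)
Definition append_chain y m : chain X m -> chain X m.+1 :=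
  fglift (fun x : m.+1.-tuple X => << [tuple of rcons x y] >> : chain X m.+1).

Lemma append_chain_is_additive y m : zmod_morphism (@append_chain y m).
Proof. exact: lift_is_additive. Qed.
HB.instance Definition _ y m :=
  GRing.isZmodMorphism.Build (chain X m) (chain X m.+1) (@append_chain y m)
    (@append_chain_is_additive y m).

(** The case of the empty tuple, which spans [C_{-1}]: [1 |-> (y)]. *)
Definition point_chain y (k : int) : chain X 0 := << k *g [tuple y] >>.

Lemma point_chain_is_additive y : zmod_morphism (point_chain y).
Proof. by move=> k l; rewrite /point_chain freegUB. Qed.
HB.instance Definition _ y :=
  GRing.isZmodMorphism.Build int (chain X 0) (point_chain y)
    (point_chain_is_additive y).

(** Appending [y], as a degree 1 map of the augmented chain groups. Like
    [achain], it is shifted by one: [cone y m] starts from [C_{m-1}]. *)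
Definition cone y m : {additive achain X m -> achain X m.+1} :=
  match m with
  | 0 => point_chain y
  | m'.+1 => @append_chain y m'
  end.

(** [(x_0, ..., x_m) |-> (f x_0, ..., f x_m)]. *)
Definition map_chain (f : X -> X) m : chain X m -> chain X m :=
  fglift (fun x : m.+1.-tuple X => << [tuple of map f x] >> : chain X m).

Lemma map_chain_is_additive f m : zmod_morphism (@map_chain f m).
Proof. exact: lift_is_additive. Qed.
HB.instance Definition _ f m :=
  GRing.isZmodMorphism.Build (chain X m) (chain X m) (@map_chain f m)
    (@map_chain_is_additive f m).

Lemma face_tuple_rcons op y m (i : 'I_m.+2) (x : m.+2.-tuple X) :
  face_tuple op (widen_ord (leqnSn _) i) [tuple of rcons x y] =
  [tuple of rcons (face_tuple op i x) y].
Proof.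
apply: val_inj; apply: (@eq_from_nth _ y) => [|k].
  by rewrite [LHS]size_tuple [RHS]size_tuple.
rewrite [size _]size_tuple => ltk.
have lti := ltn_ord i.
rewrite nth_face_tuple // !nth_rcons !size_tuple [nat_of_ord (widen_ord _ _)]/=.
have [ltkm|lemk] := ltnP k m.+1; last first.
  have -> : (k < i)%N = false by lia.
  have -> : (k.+1 < m.+2)%N = false by lia.
  have -> : k = m.+1 by lia.
  by rewrite !eqxx.
rewrite nth_face_tuple // lti.
have -> : (k.+1 < m.+2)%N by lia.
by have -> : (k < m.+2)%N by lia.
Qed.

Lemma face_tuple_rcons_max op y m (x : m.+1.-tuple X) :
  face_tuple op ord_max [tuple of rcons x y] = [tuple of map (op^~ y) x].
Proof.
apply: val_inj; apply: (@eq_from_nth _ y) => [|k].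
  by rewrite [LHS]size_tuple [RHS]size_tuple.
rewrite [size _]size_tuple => ltk.
rewrite nth_face_tuple //= !nth_rcons !size_tuple ltk ltnn eqxx.
by rewrite (nth_map y) ?size_tuple.
Qed.

(** Appending [y] is a homotopy, up to sign, between zero and the right
    translation by [y] acting on each entry. *)
Lemma augmented_bd_cone op y m (c : chain X m) :
  augmented_bd op m.+1 (cone y m.+1 c) =
  cone y m (augmented_bd op m c) + (-1) ^+ m.+1 *: map_chain (op^~ y) c.
Proof.
pose F := augmented_bd op m.+1 \o cone y m.+1.
pose G := (cone y m \o augmented_bd op m)
  \+ ((-1) ^+ m.+1 \*: map_chain (op^~ y) (m := m)).
apply: (@freeg_ext _ _ F G) => x; rewrite {}/F {}/G {c} /=.
rewrite /append_chain /map_chain !liftU !scale1r /one_term_bd big_ord_recr /=.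
rewrite {2}/face liftU scale1r face_tuple_rcons_max; congr (_ + _).
case: m x => [|m] x /=.
  rewrite big_ord_recl big_ord0 addr0 scale1r /face liftU scale1r.
  rewrite /augmentation liftU /point_chain; congr << _ >>.
  apply: eq_from_tnth => j; rewrite (ord1 j) tnth_mktuple /= !(tnth_nth y) /=.
  by rewrite nth_rcons size_tuple.
rewrite [RHS](raddf_sum (append_chain y (m := m))); apply: eq_bigr => i _.
rewrite raddfZsign /= /face !liftU !scale1r face_tuple_rcons.
by rewrite /append_chain liftU scale1r.
Qed.

Lemma map_chain_id f m (c : chain X m) : f =1 id -> map_chain f c = c.
Proof.
move=> f_id; apply: (@freeg_ext _ _ (map_chain f (m := m)) idfun) => x /=.
rewrite /map_chain liftU scale1r; congr << _ >>; apply: val_inj => /=.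
by rewrite (eq_map f_id) map_id.
Qed.

(** When [f] is constant, [map_chain f] factors through the sum of coefficients
    [deg]. *)
Lemma map_chain_const f e m (c : chain X m) :
  (forall x, f x = e) -> deg c = 0 -> map_chain f c = 0.
Proof.
move=> f_e c0.
pose h0 (k : int) : chain X m := << k *g [tuple of nseq m.+1 e] >>.
have h0_additive : zmod_morphism h0 by move=> k l; rewrite /h0 freegUB.
pose hM := GRing.isZmodMorphism.Build _ _ h0 h0_additive.
pose h : {additive int -> chain X m} := HB.pack h0 hM.
pose G := h \o @deg (m.+1.-tuple X).
rewrite (@freeg_ext _ _ (map_chain f (m := m)) G) => [|x].
  by rewrite /G /= c0 /h0 freegU0.
rewrite /G /= /h0 /map_chain liftU scale1r degU; congr << _ >>.
by apply: eq_from_tnth => j; rewrite tnth_map f_e (tnth_nth e) nth_nseq if_same.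
Qed.

Lemma deg_face op m (i : 'I_m.+2) (c : chain X m.+1) :
  deg (face op i c) = deg c.
Proof.
apply: (@freeg_ext _ _ (@deg _ \o face op i) (@deg _)) => x /=.
by rewrite /face liftU scale1r !degU.
Qed.

Lemma deg_rack_bd0 op m (c : achain X m.+2) :
  deg (rack_bd0 op m.+1 c) = 0.
Proof.
rewrite /= /rack_bd raddf_sum big1 //= => i _.
rewrite -signr_odd scaler_sign (fun_if (@deg _)) degN degB !deg_face subrr.
by rewrite oppr0 if_same.
Qed.

Lemma rack_bd0_nseq op e m :
  op e e = e -> rack_bd0 op m << [tuple of nseq m.+1 e] >> = 0.
Proof.
case: m => [|m] // ee; rewrite /= /rack_bd big1 // => i _.
rewrite /face !liftU !scale1r; set t := [tuple of _].
suff -> : face_tuple (@op0 X) i t = face_tuple op i t by rewrite subrr scaler0.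
have te j : tnth t j = e by rewrite (tnth_nth e) nth_nseq if_same.
by apply: eq_from_tnth => j; rewrite !tnth_mktuple /= !te ee.
Qed.

(** Also in degree 0, where the two augmentations cancel. *)
Lemma rack_bd0E op m (c : chain X m) :
  rack_bd0 op m c = augmented_bd (@op0 X) m c - augmented_bd op m c.
Proof. by case: m c => [|m] c /=; rewrite ?subrr ?rack_bdE. Qed.

(** Appending [y] is a homotopy, up to sign, between the identity and the right
    translation by [y]; the identity comes from the trivial operation. *)
Lemma rack_bd0_cone op y m (c : chain X m) :
  rack_bd0 op m.+1 (cone y m.+1 c) =
  cone y m (rack_bd0 op m c) + (-1) ^+ m.+1 *: (c - map_chain (op^~ y) c).
Proof.
rewrite (rack_bd0E op (m := m.+1)) !augmented_bd_cone rack_bd0E raddfB.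
by rewrite (map_chain_id (f := (@op0 X)^~ y)) // scalerBr opprD addrACA.
Qed.

(** * Homology of shelves with an identity or constant right translation *)

Lemma reduced_one_term_homology_eq0 op e m
    (h : reduced_one_term_homology op m) :
  (forall x, op x e = x) -> h = 0.
Proof.
move=> op_e; apply: homology_eq0 => c dc.
exists (cone e m.+1 ((-1) ^+ m.+1 *: (c : chain X m))).
rewrite raddfZsign [LHS]raddfZsign augmented_bd_cone dc raddf0 add0r.
by rewrite map_chain_id // signrZK.
Qed.

Lemma rack_homology_int op z e m :
    right_self_distributive op -> (forall x, op x z = e) ->
  zmod_isomorphic (rack_homology op m) int.
Proof.
move=> sd op_z.
(* op e e = op (op z z) (op z z) = op (op z z) z = e *)
have ee : op e e = e by rewrite -{3}(op_z (op z z)) sd !op_z.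
apply: (@homology_int _ _ _ _ _ (@deg (m.+1.-tuple X))
          << [tuple of nseq m.+1 e] >>).
- exact: deg_rack_bd0.
- exact: rack_bd0_nseq.
- exact: degU.
move=> c dc c0.
exists (cone z m.+1 ((-1) ^+ m.+1 *: (c : chain X m))).
rewrite raddfZsign [LHS]raddfZsign rack_bd0_cone dc raddf0 add0r.
by rewrite (map_chain_const op_z c0) subr0 signrZK.
Qed.

End Cone.

(** * Two rows of a Laver table *)

Section LaverTable.
Variables (n : nat)
  (star : laver_carrier n -> laver_carrier n -> laver_carrier n).
Hypothesis star_laver : is_laver_table star.

Lemma laver_carrier_modn_inj (a b : laver_carrier n) :
  (sval a = sval b %[mod 2 ^ n])%N -> a = b.
Proof.
have modE (c : laver_carrier n) :
    (sval c %% 2 ^ n = if sval c == 2 ^ n then 0 else sval c)%N.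
  have /andP[_ cN] := svalP c; case: eqP => [->|/eqP c_neN].
    by rewrite modnn.
  by rewrite modn_small // ltn_neqAle c_neN.
rewrite !modE => ab; apply: val_inj => /=.
by move: (svalP a) (svalP b) ab; do 2!case: eqP => //; lia.
Qed.

Lemma laver_mul_one_succ a b :
  sval b = (sval a).+1 -> star a (laver_one n) = b.
Proof.
move=> ba; apply: laver_carrier_modn_inj.
by rewrite (laver_mul_one star_laver) addn1 ba.
Qed.

Lemma laver_mul_one_max a :
  sval a = (2 ^ n)%N -> star a (laver_one n) = laver_one n.
Proof.
move=> aN; apply: laver_carrier_modn_inj.
by rewrite (laver_mul_one star_laver) aN modnDl.
Qed.

(** Every element is reached from 1 by repeatedly multiplying by 1 on the
    right. *)
Lemma laver_ind (P : laver_carrier n -> Prop) :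
    P (laver_one n) -> (forall a, P a -> P (star a (laver_one n))) ->
  forall a, P a.
Proof.
move=> P1 PS [k]; elim: k => [|k IH] // kP.
have [k0|k0] := posnP k.
  by have -> : exist _ k.+1 kP = laver_one n by apply: val_inj; rewrite /= k0.
have kP' : (0 < k <= 2 ^ n)%N by case/andP: kP => _ /ltnW ->; rewrite k0.
have <- := @laver_mul_one_succ (exist _ k kP') (exist _ k.+1 kP) erefl.
exact: PS.
Qed.

Lemma laver_max_mul a b : sval a = (2 ^ n)%N -> star a b = b.
Proof.
move=> aN; elim/laver_ind: b => [|b IH]; first exact: laver_mul_one_max.
by rewrite (laver_left_distributive star_laver) IH laver_mul_one_max.
Qed.

Lemma laver_pred_max_mul a b c :
  (sval a).+1 = (2 ^ n)%N -> sval c = (2 ^ n)%N -> star a b = c.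
Proof.
move=> aN cN; have a1 : star a (laver_one n) = c.
  by apply: laver_mul_one_succ; rewrite cN aN.
elim/laver_ind: b => [|b IH] //.
by rewrite (laver_left_distributive star_laver) IH a1 laver_max_mul.
Qed.

End LaverTable.

Theorem corollary3p12 (n : nat) (n_gt0 : (0 < n)%N)
    (star : laver_carrier n -> laver_carrier n -> laver_carrier n)
    (star_laver : is_laver_table star) :
  (forall (m : nat) (h : reduced_one_term_homology (transpose_op star) m),
      h = 0%R) /\
  (forall m : nat,
      zmod_isomorphic (rack_homology (transpose_op star) m) int).
Proof.
have N_gt1 : (1 < 2 ^ n)%N by rewrite -(expn0 2) ltn_exp2l.
have NP : (0 < 2 ^ n <= 2 ^ n)%N by rewrite expn_gt0 leqnn.
have N1P : (0 < (2 ^ n).-1 <= 2 ^ n)%N by lia.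
pose N : laver_carrier n := exist _ (2 ^ n)%N NP.
pose N1 : laver_carrier n := exist _ (2 ^ n).-1 N1P.
split=> m; first move=> h.
  apply: (@reduced_one_term_homology_eq0 _ _ N) => x.
  exact: (laver_max_mul star_laver).
apply: (@rack_homology_int _ _ N1 N).
  exact: laver_transpose_right_self_distributive.
move=> x; apply: (laver_pred_max_mul star_laver) => //=.
by rewrite prednK // ltnW.
Qed.
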